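(* Let $X$ and $U$ be Hilbert spaces, let $A_0:\operatorname{dom}A_0\subset X\to X$ be skew-adjoint, let $D\in\mathcal L(U,X)$, and let $A=A_0-DD^*$ with $\operatorname{dom}A=\operatorname{dom}A_0$. For $a<b$ let $P_{(a,b)}\in\mathcal L(X)$ be the spectral projection of $A_0$ corresponding to the interval $(ia,ib)\subset i\mathbb R$. Assume there exist $\eta_0,\delta_0>0$ and functions $\eta:\mathbb R\to(0,\eta_0]$ and $\delta:\mathbb R\to(0,\delta_0]$ such that for every $s\in\mathbb R$ $$\|D^*x\|\ge \eta(s)\|x\|\qquad\text{for all } x\in\operatorname{ran}P_{(s-\delta(s),\,s+\delta(s))}.$$ Then $i\mathbb R\subset\rho(A)$ and $$\|R(is,A)\|\le\frac{M_R}{\eta(s)^2\delta(s)^2}\qquad\text{for all } s\in\mathbb R,$$ where $$M_R=2\sqrt{\eta_0^4\delta_0^2+2\eta_0^2\delta_0^2\|D\|^2+\bigl(\delta_0^2+\eta_0^2\|D\|^2+2\|D\|^4\bigr)^2}.$$ Suppose in addition that there exist $M_0>0$ and $\alpha>0$ such that $\eta(s)^{-2}\delta(s)^{-2}\le M_0(1+|s|^\alpha)$ for all $s\in\mathbb R$, and let $\beta,\gamma\ge0$ satisfy $\beta+\gamma=\lceil\alpha\rceil$. Let $s_0>0$ be arbitrary and define $$M_C=\max\left\{M_RM_0\|A^{-1}\|^{\lceil\alpha\rceil}(1+s_0^\alpha),\ \frac{M_RM_0(1+s_0^\alpha)}{s_0^{\lceil\alpha\rceil}}+\sum_{k=1}^{\lceil\alpha\rceil}\frac{\|A^{-1}\|^k}{s_0^{\lceil\alpha\rceil+1-k}}\right\}.$$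 Then every $\kappa>0$ with $\kappa<\frac{1}{\sqrt{2M_C}}$ is an admissible constant for the exponents $\beta,\gamma$, that is, $$\kappa<\frac{1}{\sup_{\lambda\in\mathbb C_+}\|R(\lambda,A)(-A)^{-\beta-\gamma}\|^{1/2}}.$$
   Context: Hilbert spaces are complex. $\mathcal L(U,X)$ denotes the bounded linear operators, $R(\lambda,A)=(\lambda-A)^{-1}$ for $\lambda\in\rho(A)$, $\mathbb C_+=\{\lambda\in\mathbb C:\operatorname{Re}\lambda>0\}$, and $\lceil\alpha\rceil$ is the ceiling of $\alpha$. The operator $A$ generates a contraction semigroup, so $\mathbb C_+\subset\rho(A)$. The displayed upper bound on $\kappa$ is exactly the condition imposed on the constant $\kappa$ in a known perturbation theorem: if the semigroup generated by $A$ is polynomially stable with $\alpha$, $\beta+\gamma\ge\alpha$, $\kappa$ satisfies this bound, and $B\in\mathcal L(Y,X)$, $C\in\mathcal L(X,Y)$ are such that $\operatorname{ran}B\subset\operatorname{dom}(-A)^\beta$, $\operatorname{ran}C^*\subset\operatorname{dom}(-A^* )^\gamma$, $(-A)^\beta B$ and $(-A^* )^\gamma C^*$ are Hilbert--Schmidt, and $\|(-A)^\beta B\|<\kappa$, $\|(-A^* )^\gamma C^*\|<\kappa$, then the semigroup generated by $A+BC$ is polynomially stable with the same $\alpha$. *)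

(* Defs.v *)
From HB Require Import structures.
From mathcomp Require Import all_boot all_order all_algebra.
From mathcomp Require Import all_classical all_reals all_analysis.
From mathcomp Require Import complex.

Set Implicit Arguments.
Unset Strict Implicit.
Unset Printing Implicit Defensive.

Import Order.TTheory GRing.Theory Num.Theory.
Import numFieldNormedType.Exports.

Local Open Scope classical_set_scope.
Local Open Scope ring_scope.
Local Open Scope complex_scope.

(* The form is linear in its first argument, conjugate-linear in its second. *)
Structure hilbertType (R : realType) := HilbertType {
  hilbert_sort :> completeNormedModType R[i];
  hilbert_form : {dot hilbert_sort for (@Num.conj R[i])};
  hilbert_normE : forall x : hilbert_sort, `|x| ^+ 2 = hilbert_form x x }.

Definition inner (R : realType) (X : hilbertType R) (x y : X) : R[i] :=
  hilbert_form X x y.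

Section Operators.
Context {R : realType}.
Implicit Types X Y : hilbertType R.

(* The norm of the normed module takes its values in R[i]. *)
Definition normR X (x : X) : R := complex.Re `|x|.

Definition opnorm X Y (T : X -> Y) : \bar R :=
  ereal_sup [set (normR (T x))%:E | x in [set x | normR x <= 1]].

Definition is_adjoint X Y (T : X -> Y) (Ts : Y -> X) : Prop :=
  forall x y, inner (T x) y = inner x (Ts y).

(* A partially defined operator; its values outside [dom] are irrelevant. *)
Record operator X := Operator { dom : set X; apply :> X -> X }.

Definition linear_operator X (A : operator X) : Prop :=
  dom A 0 /\
  forall (a : R[i]) x y, dom A x -> dom A y ->
    dom A (a *: x + y) /\ A (a *: x + y) = a *: A x + A y.

(* (y, z) belongs to the graph of the Hilbert space adjoint of A. *)
Definition adjoint_graph X (A : operator X) (y z : X) : Prop :=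
  forall x, dom A x -> inner (A x) y = inner x z.

Definition skew_adjoint X (A : operator X) : Prop :=
  [/\ linear_operator A, closure (dom A) = setT &
      forall y z, adjoint_graph A y z <-> dom A y /\ z = - A y].

Definition op_opp X (A : operator X) : operator X :=
  Operator (dom A) (fun x => - A x).

Definition op_shift X (lambda : R[i]) (A : operator X) : operator X :=
  Operator (dom A) (fun x => lambda *: x + A x).

(* A0 - D D^*, on the domain of A0; Ds stands for D^*. *)
Definition damped X Y (A0 : operator X) (D : Y -> X) (Ds : X -> Y) :
    operator X :=
  Operator (dom A0) (fun x => A0 x - D (Ds x)).

(* The value at y is 0 when y is not in the range of A. *)
Definition op_inv X (A : operator X) (y : X) : X :=
  xget 0 [set x | dom A x /\ A x = y].

Definition resolvent X (lambda : R[i]) (A : operator X) : X -> X :=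
  op_inv (op_shift lambda (op_opp A)).

(* lambda - A is a bijection from dom A onto X, with bounded inverse. *)
Definition resolvent_set X (A : operator X) : set R[i] :=
  [set lambda |
    (forall y, exists! x, dom A x /\ lambda *: x - A x = y) /\
    continuous (resolvent lambda A)].

Definition cRintegral (S : set R) (f : R -> R[i]) : R[i] :=
  (\int[lebesgue_measure]_(t in S) complex.Re (f t))
  +i* (\int[lebesgue_measure]_(t in S) complex.Im (f t)).

(* B^(- theta) for 0 <= theta < 1, by Balakrishnan's formula
   sin(pi theta) / pi * \int_0^oo t^(- theta) (t + B)^-1 dt when theta > 0,
   the integral being understood weakly. *)
Definition frac_neg_power X (B : operator X) (theta : R) (x : X) : X :=
  if theta == 0 then x else
  xget 0 [set z | forall y, inner z y =
    (sin (pi * theta) / pi)%:C *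
    cRintegral `]0, +oo[%classic
      (fun t => (t `^ (- theta))%:C * inner (op_inv (op_shift t%:C B) x) y)].

(* B^(- sigma) for sigma >= 0, as the integer power B^(- floor sigma) composed
   with the power of exponent floor sigma - sigma. *)
Definition neg_power X (B : operator X) (sigma : R) (x : X) : X :=
  iter (Num.truncn sigma) (op_inv B)
    (frac_neg_power B (sigma - (Num.truncn sigma)%:R) x).

Definition projection_valued_measure X (E : set R -> {linear X -> X}) : Prop :=
  [/\ (forall S, measurable S -> is_adjoint (E S) (E S)),
      (forall S T, measurable S -> measurable T ->
         forall x, E (S `&` T) x = E S (E T x)),
      (forall x, E setT x = x) &
      (forall F : nat -> set R, (forall n, measurable (F n)) ->
         trivIset setT F ->
         forall x, \sum_(0 <= n < N) E (F n) x @[N --> \oo]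
                     --> E (\bigcup_n F n) x)].

(* A = \int i t dE(t): with mu the measure S |-> <E(S) x, x>, the vector x is
   in dom A if and only if \int t^2 dmu is finite, and then
   <A x, x> = i \int t dmu; by polarization this determines A. *)
Definition spectral_measure X (A : operator X) (E : set R -> {linear X -> X}) :
    Prop :=
  projection_valued_measure E /\
  forall x, exists mu : {measure set R -> \bar R},
    [/\ (forall S, measurable S -> mu S = (complex.Re (inner (E S x) x))%:E),
        dom A x <-> (\int[mu]_t (t ^+ 2)%:E < +oo)%E &
        dom A x -> inner (A x) x = (\int[mu]_t t) *i ].

(* P is the spectral projection of the skew-adjoint A for the interval
   (ia, ib) of the imaginary axis. *)
Definition spectral_projection X (A : operator X) (a b : R)
    (P : {linear X -> X}) : Prop :=
  exists2 E, spectral_measure A E & forall x, P x = E `]a, b[%classic x.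

(* The upper bound imposed on kappa for the exponents beta and gamma; when the
   supremum is 0 its inverse is +oo. *)
Definition admissible X (A : operator X) (beta gamma kappa : R) : Prop :=
  (kappa%:E <
   1 / ereal_sup [set poweR
         (opnorm (resolvent lambda A \o neg_power (op_opp A) (beta + gamma)))
         2^-1 | lambda in [set lambda : R[i] | 0 < complex.Re lambda]%R])%E.

End Operators.

Definition const_MR (R : realType) (eta0 delta0 d : R) : R :=
  2 * Num.sqrt (eta0 ^+ 4 * delta0 ^+ 2 + 2 * eta0 ^+ 2 * delta0 ^+ 2 * d ^+ 2
                + (delta0 ^+ 2 + eta0 ^+ 2 * d ^+ 2 + 2 * d ^+ 4) ^+ 2).

(* a stands for the norm of the inverse of A and n for the ceiling of alpha. *)
Definition const_MC (R : realType) (MR M0 a alpha : R) (n : nat) (s0 : R) : R :=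
  Num.max
    (MR * M0 * a ^+ n * (1 + s0 `^ alpha))
    (MR * M0 * (1 + s0 `^ alpha) / s0 ^+ n
     + \sum_(1 <= k < n.+1) a ^+ k / s0 ^+ (n.+1 - k)).

(* Main.v *)
Require Import Defs.
From mathcomp Require Import all_boot all_order all_algebra.
From mathcomp Require Import all_classical all_reals all_analysis.
From mathcomp Require Import measurable_realfun complex ring lra.

(* Put T = is - A, y = T x, and split x = P x + Q x by the spectral projection P
   of A0 for the interval around is of radius delta(s), with Q = 1 - P.
   Dissipativity gives |D^* x|^2 <= |y| |x|; A0 commutes with Q and
   delta |Q x| <= |Q (A0 - is) x| <= |y| + |D| |D^* x|; observability gives
   eta |P x| <= |D^* x| + |D| |Q x|. Combining the three with
   |x|^2 = |P x|^2 + |Q x|^2 yields |x| <= M_R / (eta delta)^2 |y|. Since the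
   orthogonal complement of the range of T is killed by T itself, T is onto.

   With B = (-A)^-1, the identity R(is) B = (is)^-1 (B - R(is)) iterated n times
   bounds R(is) B^n by M_C on the imaginary axis. For Re lambda > 0 and
   s = Im lambda, w = R(is) z and x = R(lambda) z satisfy
   (lambda - A)(x - w) = - (Re lambda) w, so dissipativity gives |x| <= 2 |w|. *)

Set Implicit Arguments.
Unset Strict Implicit.
Unset Printing Implicit Defensive.

Import Order.TTheory GRing.Theory Num.Theory.
Import numFieldNormedType.Exports.

Local Open Scope classical_set_scope.
Local Open Scope ring_scope.
Local Open Scope complex_scope.

(** * Real inner product, real-valued norm and operator norm on a complex Hilbert space *)

Lemma ReZ (R : realType) (a : R) (z : R[i]) :
  complex.Re (a%:C * z) = a * complex.Re z.
Proof. by case: z => x y /=; rewrite mul0r subr0. Qed.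

Lemma ltr0c (R : realType) (k : R) : (0 < k%:C) = (0 < k).
Proof. exact: ltcR. Qed.

Section Hilbert.
Context {R : realType}.
Implicit Types X Y : hilbertType R.

Lemma innerDl X (x y z : X) : inner (x + y) z = inner x z + inner y z.
Proof. exact: linearDl. Qed.
Lemma innerDr X (x y z : X) : inner x (y + z) = inner x y + inner x z.
Proof. exact: linearDr. Qed.
Lemma innerNl X (x y : X) : inner (- x) y = - inner x y.
Proof. exact: linearNl. Qed.
Lemma innerNr X (x y : X) : inner x (- y) = - inner x y.
Proof. exact: linearNr. Qed.
Lemma inner0l X (x : X) : inner 0 x = 0.
Proof. exact: linear0l. Qed.
Lemma innerZl X (a : R[i]) (x y : X) : inner (a *: x) y = a * inner x y.
Proof. exact: linearZl_LR. Qed.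
Lemma innerZr X (a : R[i]) (x y : X) : inner x (a *: y) = a^* * inner x y.
Proof. exact: linearZr_LR. Qed.
Lemma innerC X (x y : X) : inner y x = (inner x y)^*.
Proof. by rewrite /inner hermC mul1r. Qed.

(** The inner product of the underlying real Hilbert space, used for the estimates; testing with
    ['i *: x] as well recovers complex values. *)
Definition reinner X (x y : X) : R := complex.Re (inner x y).

Lemma reinnerDl X (x y z : X) : reinner (x + y) z = reinner x z + reinner y z.
Proof. by rewrite /reinner innerDl raddfD. Qed.
Lemma reinnerDr X (x y z : X) : reinner x (y + z) = reinner x y + reinner x z.
Proof. by rewrite /reinner innerDr raddfD. Qed.
Lemma reinnerNl X (x y : X) : reinner (- x) y = - reinner x y.
Proof. by rewrite /reinner innerNl raddfN. Qed.
Lemma reinnerNr X (x y : X) : reinner x (- y) = - reinner x y.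
Proof. by rewrite /reinner innerNr raddfN. Qed.
Lemma reinner0l X (x : X) : reinner 0 x = 0.
Proof. by rewrite /reinner inner0l. Qed.
Lemma reinnerZl X (a : R) (x y : X) : reinner (a%:C *: x) y = a * reinner x y.
Proof. by rewrite /reinner innerZl ReZ. Qed.
Lemma reinnerC X (x y : X) : reinner y x = reinner x y.
Proof. by rewrite /reinner innerC; case: (inner x y). Qed.
Lemma reinnerZr X (a : R) (x y : X) : reinner x (a%:C *: y) = a * reinner x y.
Proof. by rewrite -reinnerC reinnerZl reinnerC. Qed.

Lemma normRE X (x : X) : (normR x)%:C = `|x|.
Proof. by rewrite /normR RRe_real// ger0_real. Qed.

Lemma normR_ge0 X (x : X) : 0 <= normR x.
Proof. by rewrite -ler0c normRE. Qed.

Lemma innerxx X (x : X) : inner x x = (normR x ^+ 2)%:C.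
Proof. by rewrite /inner -hilbert_normE -normRE rmorphXn. Qed.

Lemma normR2 X (x : X) : normR x ^+ 2 = reinner x x.
Proof. by rewrite /reinner innerxx. Qed.

Lemma normR0_eq0 X (x : X) : normR x = 0 -> x = 0.
Proof. by move=> x0; apply/eqP; rewrite -normr_eq0 -normRE x0. Qed.

Lemma normR0 X : normR (0 : X) = 0.
Proof. by rewrite /normR normr0. Qed.

Lemma normRN X (x : X) : normR (- x) = normR x.
Proof. by rewrite /normR normrN. Qed.

Lemma normRB X (x y : X) : normR (x - y) = normR (y - x).
Proof. by rewrite -normRN opprB. Qed.

Lemma normR_triangle X (x y : X) : normR (x + y) <= normR x + normR y.
Proof. by rewrite -lecR rmorphD/= !normRE ler_normD. Qed.

Lemma normRZ X (a : R[i]) (x : X) :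
  normR (a *: x) = complex.Re `|a| * normR x.
Proof.
by apply: (@complexI R); rewrite normRE rmorphM/= normRE normrZ.
Qed.

Lemma normR_sqrD X (x y : X) :
  normR (x + y) ^+ 2 = normR x ^+ 2 + normR y ^+ 2 + 2 * reinner x y.
Proof. by rewrite !normR2 !reinnerDl !reinnerDr (reinnerC x y); ring. Qed.

Lemma parallelogram X (x y : X) :
  normR (x + y) ^+ 2 + normR (x - y) ^+ 2 = 2 * (normR x ^+ 2 + normR y ^+ 2).
Proof. by rewrite !normR_sqrD normRN reinnerNr; ring. Qed.

(** Cauchy-Schwarz comes from squaring the triangle inequality, which the normed module supplies. *)
Lemma reinner_le X (x y : X) : reinner x y <= normR x * normR y.
Proof.
have : normR (x + y) ^+ 2 <= (normR x + normR y) ^+ 2.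
  by rewrite ler_sqr ?nnegrE ?addr_ge0 ?normR_ge0// normR_triangle.
by rewrite normR_sqrD sqrrD mulr2n; lra.
Qed.

Lemma abs_reinner_le X (x y : X) : `|reinner x y| <= normR x * normR y.
Proof.
rewrite ler_norml reinner_le andbT lerNl -reinnerNl -(normRN x).
exact: reinner_le.
Qed.

Lemma reinner_iZl X (x y : X) : reinner ('i *: x) y = - complex.Im (inner x y).
Proof. by rewrite /reinner innerZl mulrC ReiNIm. Qed.

Lemma inner_eq0 X (x y : X) :
  reinner x y = 0 -> reinner ('i *: x) y = 0 -> inner x y = 0.
Proof.
rewrite reinner_iZl /reinner => r0 /eqP; rewrite oppr_eq0 => /eqP i0.
by apply/eqP; rewrite eq_complex r0 i0 !eqxx.
Qed.

(** If [x] were nonzero, density would give [y] in [S] with [|x - y| < |x|], whereas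
    [|x|^2 = Re <x, x - y> <= |x| |x - y|]. *)
Lemma dense_ortho X (S : set X) (x : X) : closure S = setT ->
  (forall y, S y -> reinner x y = 0) -> x = 0.
Proof.
move=> dS xS; apply: normR0_eq0; apply/eqP/negPn/negP => x0.
have xp : 0 < normR x by rewrite lt_def x0 normR_ge0.
have : closure S x by rewrite dS.
have xpC : 0 < `|x| by rewrite -normRE ltcR.
move=> /(_ _ (nbhsx_ballx x _ xpC)) [y [Sy]].
rewrite -ball_normE /= -!normRE ltcR => yx.
have := reinner_le x (x - y); rewrite reinnerDr reinnerNr (xS y Sy) subr0 -normR2.
by rewrite expr2 ler_pM2l// leNgt yx.
Qed.

Lemma cauchy_normR X (u : nat -> X) :
  (forall e, 0 < e -> exists N, forall m n, (N <= m)%N -> (N <= n)%N ->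
     normR (u m - u n) < e) ->
  exists l, forall e, 0 < e -> exists N, forall n, (N <= n)%N ->
     normR (u n - l) < e.
Proof.
move=> cu; have cvu : cvg (u @ \oo).
  apply/cauchy_cvgP/cauchy_exP => e e0.
  (* A positive element of [R[i]] is real, so the tolerances of the complex-valued norm reduce to
     real ones. *)
  have eR : e = (complex.Re e)%:C by rewrite RRe_real// gtr0_real.
  move: e0; rewrite eR ltr0c => /cu [N hN]; exists (u N); exists N => // n /= Nn.
  by rewrite -ball_normE /= -normRE ltcR hN.
exists (lim (u @ \oo)) => e e0.
have e0C : 0 < e%:C by rewrite ltr0c.
have /cvgrPdist_lt/(_ _ e0C)[N _ hN] := cvu.
exists N => n /hN /=; by rewrite -normRE ltcR normRB.
Qed.

Lemma lipschitz_continuous X Y (f : X -> Y) (M : R) :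
  (forall x y, normR (f x - f y) <= M * normR (x - y)) -> continuous f.
Proof.
move=> fM x; apply/cvgrPdist_lt => e e0.
have eR : e = (complex.Re e)%:C by rewrite RRe_real// gtr0_real.
move: e0; rewrite eR ltr0c => e0.
have M0 : 0 < `|M| + 1 by rewrite ltr_pwDr.
apply/nbhs_normP; exists (complex.Re e / (`|M| + 1))%:C => /=.
  by rewrite ltr0c divr_gt0.
move=> y /=; rewrite -!normRE !ltcR ltr_pdivlMr// => yx.
apply: le_lt_trans (fM x y) (le_lt_trans _ yx).
rewrite mulrC ler_wpM2l ?normR_ge0//.
by apply: le_trans (ler_norm _) _; rewrite lerDl.
Qed.

Lemma continuous_normR_bounded X Y (f : {linear X -> Y}) : continuous f ->
  exists M, 0 <= M /\ forall x, normR (f x) <= M * normR x.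
Proof.
move=> /(_ 0)/cvgrPdist_lt/(_ 1 ltr01)/nbhs_normP[e /= e0 fe].
have eR : e = (complex.Re e)%:C by rewrite RRe_real// gtr0_real.
move: e0 fe; rewrite eR ltr0c; set r := complex.Re e => r0 fe.
exists (2 / r); split; first by rewrite divr_ge0// ltW.
move=> x; have [->|x0] := eqVneq x 0; first by rewrite linear0 !normR0 mulr0.
have xp : 0 < normR x.
  by rewrite lt_def normR_ge0 andbT; apply: contra_neq x0 => /normR0_eq0.
(* Scaling [x] by [a] gives norm [r / 2], inside the ball of radius [r] that [f] maps into the unit
   ball; hence the constant [2 / r]. *)
pose a := r / 2 / normR x.
have a0 : 0 < a by rewrite divr_gt0// divr_gt0.
have normaZ (V : hilbertType R) (v : V) : normR (a%:C *: v) = a * normR v.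
  by rewrite normRZ ger0_norm ?ler0c ?(ltW a0).
have := fe (a%:C *: x); rewrite /ball_ /= !linear0 !sub0r !normrN -!normRE.
rewrite ltcR normaZ /a divfK ?gt_eqF// ltr_pdivrMr// ltr_pMr// ltr1n => /(_ isT).
rewrite linearZ /= normaZ ltcR => /ltW.
rewrite /a -ler_pdivlMl ?a0// invfM invf_div invrK mulr1 mulrC.
by rewrite mulrC.
Qed.

Lemma opnorm_le X Y (T : X -> Y) (M : R) :
  (forall x, normR x <= 1 -> normR (T x) <= M) -> (opnorm T <= M%:E)%E.
Proof. by move=> TM; apply: ge_ereal_sup => _ [x x1 <-]; rewrite lee_fin TM. Qed.

Lemma opnorm_ge0 X Y (T : X -> Y) : (0 <= opnorm T)%E.
Proof.
apply: (@le_trans _ _ (normR (T 0))%:E); first by rewrite lee_fin normR_ge0.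
by apply: ereal_sup_ubound; exists 0 => //=; rewrite normR0 ler01.
Qed.

(** The bound [M] makes [opnorm T] finite, since [fine] would send an infinite value to 0;
    homogeneity then reduces to unit vectors. *)
Lemma opnorm_bound X Y (T : X -> Y) (M : R) :
  (forall (a : R[i]) x, T (a *: x) = a *: T x) ->
  (forall x, normR x <= 1 -> normR (T x) <= M) ->
  forall x, normR (T x) <= fine (opnorm T) * normR x.
Proof.
move=> TZ TM x; have [x0|x0] := eqVneq (normR x) 0.
  have -> : x = 0 *: x by rewrite scale0r (normR0_eq0 x0).
  by rewrite TZ !scale0r !normR0 mulr0.
have xp : 0 < normR x by rewrite lt_def x0 normR_ge0.
have fin : opnorm T \is a fin_num.
  by rewrite ge0_fin_numE ?opnorm_ge0// (le_lt_trans (opnorm_le TM))// ltry.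
have nZ (V : hilbertType R) (v : V) :
    normR (((normR x)^-1)%:C *: v) = (normR x)^-1 * normR v.
  by rewrite normRZ ger0_norm ?ler0c ?invr_ge0 ?normR_ge0.
rewrite -ler_pdivrMr// mulrC -nZ -TZ -lee_fin fineK//.
apply: ereal_sup_ubound; exists (((normR x)^-1)%:C *: x) => //=.
by rewrite nZ mulVf.
Qed.

End Hilbert.

(** * Elementary real estimates and convergence of sequences *)

Lemma invSn_lt (R : realType) (e : R) : 0 < e ->
  exists N, forall n, (N <= n)%N -> n.+1%:R^-1 < e.
Proof.
move=> e0; exists (Num.truncn e^-1) => n Nn.
rewrite -[ltRHS]invrK ltf_pV2 ?posrE ?invr_gt0 ?ltr0n//.
by apply: lt_le_trans (truncnS_gt _) _; rewrite ler_nat ltnS.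
Qed.

(** First-order condition at a minimum. The choice [t = p / (q + 1)] also covers [q = 0] and gives
    [t^2 (q + 2) <= 0]. *)
Lemma quadratic_eq0 (R : realType) (p q : R) : 0 <= q ->
  (forall t, 2 * t * p <= t ^+ 2 * q) -> p = 0.
Proof.
move=> q0 /(_ (p / (q + 1))) h.
have q1 : 0 < q + 1 by lra.
apply/eqP; rewrite -sqrf_eq0 -[_ == 0]orbF; apply/orP; left.
rewrite eq_le sqr_ge0 andbT.
have -> : p ^+ 2 = (p / (q + 1)) ^+ 2 * (q + 1) ^+ 2.
  by rewrite -exprMn divfK ?gt_eqF.
have e : 2 * (p / (q + 1)) * p = 2 * (p / (q + 1)) ^+ 2 * (q + 1).
  by rewrite -{2}[p](@divfK _ (q + 1)) ?gt_eqF//; ring.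
move: h; rewrite e => h.
have := sqr_ge0 (p / (q + 1)); set s := (_ ^+ 2) in h * => s0.
have : s * (q + 2) <= 0 by nra.
by move=> ?; have : s <= 0; nra.
Qed.

Definition tends (R : realType) (X : hilbertType R) (u : nat -> X) (l : X) :=
  forall e : R, 0 < e -> exists N, forall n, (N <= n)%N -> normR (u n - l) < e.

Lemma tends_lipschitz (R : realType) (V W : hilbertType R) (f : V -> W) (M : R) u x :
  (forall x y, normR (f x - f y) <= M * normR (x - y)) -> tends u x ->
  tends (f \o u) (f x).
Proof.
move=> fM ux e e0; have M0 : 0 < `|M| + 1 by rewrite ltr_pwDr.
have [N hN] := ux _ (divr_gt0 e0 M0); exists N => n /hN.
rewrite ltr_pdivlMr// => h; apply: le_lt_trans (fM _ _) (le_lt_trans _ h).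
rewrite mulrC ler_wpM2l ?normR_ge0//.
by apply: le_trans (ler_norm _) _; rewrite lerDl.
Qed.

Lemma tendsD (R : realType) (V : hilbertType R) (u v : nat -> V) x y :
  tends u x -> tends v y -> tends (fun n => u n + v n) (x + y).
Proof.
move=> ux vy e e0; have e20 : 0 < e / 2 by rewrite divr_gt0.
have [N1 h1] := ux _ e20; have [N2 h2] := vy _ e20.
exists (maxn N1 N2) => n; rewrite geq_max => /andP[/h1 {}h1 /h2 {}h2].
rewrite opprD addrACA; apply: le_lt_trans (normR_triangle _ _) _.
by rewrite [ltRHS](splitr e) ltrD.
Qed.

Definition closed_operator (R : realType) (X : hilbertType R) (T : operator X) :=
  forall u x y, (forall n, dom T (u n)) -> tends u x -> tends (T \o u) y ->
    dom T x /\ T x = y.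

(** * Linear partially defined operators and a surjectivity criterion *)

Section LinearOperator.
Context {R : realType} {X : hilbertType R} {T : operator X}.
Context (linT : linear_operator T).

Lemma linop0 : T 0 = 0.
Proof.
have [d0 l] := linT; have [_] := l 1 0 0 d0 d0.
rewrite !scale1r addr0 => /eqP.
by rewrite -subr_eq subrr eq_sym => /eqP.
Qed.

Lemma linopD x y : dom T x -> dom T y -> dom T (x + y) /\ T (x + y) = T x + T y.
Proof. by move=> dx dy; have := linT.2 1 x y dx dy; rewrite !scale1r. Qed.

Lemma linopZ a x : dom T x -> dom T (a *: x) /\ T (a *: x) = a *: T x.
Proof.
by move=> dx; have := linT.2 a x 0 dx linT.1; rewrite linop0 !addr0.
Qed.

Lemma linopN x : dom T x -> dom T (- x) /\ T (- x) = - T x.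
Proof. by move=> /(linopZ (-1)); rewrite !scaleN1r. Qed.

Lemma linopB x y : dom T x -> dom T y -> dom T (x - y) /\ T (x - y) = T x - T y.
Proof.
move=> dx /linopN[dy Ny]; have [? ->] := linopD dx dy.
by rewrite Ny.
Qed.

(* A minimizing sequence for the distance from z to the range is Cauchy by the
   parallelogram law; its limit is attained and the difference is orthogonal to
   the range. *)
Lemma bounded_below_surjective (c : R) : 0 < c -> closed_operator T ->
  (forall x, dom T x -> c * normR x <= normR (T x)) ->
  (forall y, (forall x, dom T x -> reinner (T x) y = 0) -> y = 0) ->
  forall z, exists x, dom T x /\ T x = z.
Proof.
move=> c0 clT bT oT z.
pose S := [set normR (z - T x) ^+ 2 | x in dom T].
pose d := inf S.
have infS : has_inf S.
  split; first by exists (normR (z - T 0) ^+ 2); exists 0 => //; exact: linT.1.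
  by exists 0 => _ [x _ <-]; exact: sqr_ge0.
have dle x : dom T x -> d <= normR (z - T x) ^+ 2.
  by move=> dx; apply: ge_inf; [exact: infS.2|exists x].
have /choice[u hu] : forall n : nat, exists x,
    dom T x /\ normR (z - T x) ^+ 2 < d + n.+1%:R^-1.
  move=> n; have n0 : 0 < n.+1%:R^-1 :> R by rewrite invr_gt0 ltr0n.
  by have [_ [x dx <-] lx] := inf_adherent n0 infS; exists x.
have du n := (hu n).1.
(* The midpoint of [u m] and [u n] lies in the domain, so its residual [h] has square norm at least
   [d]; the parallelogram law then bounds the distance of the images by the two excesses over
   [d]. *)
have gap m n :
    normR (T (u m) - T (u n)) ^+ 2 <= 2 * (m.+1%:R^-1 + n.+1%:R^-1).
  have := parallelogram (z - T (u n)) (z - T (u m)).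
  have -> : z - T (u n) - (z - T (u m)) = T (u m) - T (u n).
    by rewrite opprB addrC addrA subrK.
  have [dmn Tmn] := linopD (du m) (du n).
  have [dh Th] := linopZ (2^-1)%:C dmn.
  have := dle _ dh; rewrite Th Tmn.
  set h := z - _; have -> : z - T (u n) + (z - T (u m)) = h + h.
    rewrite /h addrACA [RHS]addrACA -!opprD; congr (_ - _).
    rewrite -scalerDl -rmorphD/= (_ : 2^-1 + 2^-1 = 1); last by lra.
    by rewrite scale1r addrC.
  rewrite (normR_sqrD h h) -normR2.
  have := (hu m).2; have := (hu n).2.
  by move: (m.+1%:R^-1) (n.+1%:R^-1) (normR (z - T (u n)) ^+ 2) => p q r; lra.
have cT e : 0 < e -> exists N, forall m n, (N <= m)%N -> (N <= n)%N ->
    normR (T (u m) - T (u n)) < e.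
  move=> e0; have e20 : 0 < e ^+ 2 / 4 by rewrite divr_gt0 ?exprn_gt0.
  have [N hN] := invSn_lt e20; exists N => m n /hN hm /hN hn.
  rewrite -ltr_sqr ?nnegrE ?normR_ge0 ?(ltW e0)//.
  apply: le_lt_trans (gap m n) _.
  by move: (m.+1%:R^-1) (n.+1%:R^-1) hm hn => p q; lra.
have [w Tw] := cauchy_normR cT.
(* The lower bound [c] transfers the Cauchy property from the images to [u]; closedness then
   identifies [w] as [T x]. *)
have [x ux] : exists x, tends u x.
  apply: cauchy_normR => e e0.
  have [N hN] := cT _ (mulr_gt0 c0 e0); exists N => m n mN nN.
  have [dB TB] := linopB (du m) (du n).
  rewrite -(ltr_pM2l c0); apply: le_lt_trans (bT _ dB) _.
  by rewrite TB hN.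
have [dx Tx] := clT _ _ _ du ux Tw.
exists x; split => //; apply/eqP; rewrite eq_sym -subr_eq0; apply/eqP/oT => y dy.
(* Orthogonality of [z - T x] to [T y] is the first-order condition for the perturbation [t *: y].
   It is tested at [u n] rather than at [x], so the inequality is obtained up to [e]. *)
rewrite reinnerC; apply: (@quadratic_eq0 _ _ (normR (T y) ^+ 2)).
  exact: sqr_ge0.
move=> t; apply/ler_addgt0Pr => e e0.
have e20 : 0 < e / 2 by rewrite divr_gt0.
have [N1 h1] := invSn_lt e20.
(* Half of [e] pays for the excess [1 / (n + 1)], half for replacing [w] by [T (u n)] in the cross
   term; the [+ 1] keeps [K] positive. *)
pose K := 2 * `|t| * normR (T y) + 1.
have K0 : 0 < K by rewrite ltr_pwDr// !mulr_ge0 ?normR_ge0.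
have [N2 h2] := Tw _ (divr_gt0 e20 K0).
pose n := maxn N1 N2.
have {}h1 := h1 n (leq_maxl _ _); have {}h2 := h2 n (leq_maxr _ _).
have [dty Tty] := linopZ t%:C dy.
have [dn Tn] := linopD (du n) dty.
have := dle _ dn; rewrite Tn Tty opprD addrA normR_sqrD normRN reinnerNr.
rewrite reinnerZr normRZ.
have -> : complex.Re `|t%:C| = `|t|.
  by rewrite normc_def /= expr0n addr0 sqrtr_sqr.
rewrite exprMn real_normK ?num_real// Tx.
have := (hu n).2.
have -> : reinner (z - w) (T y) =
    reinner (z - T (u n)) (T y) + reinner (T (u n) - w) (T y).
  by rewrite -reinnerDl addrA subrK.
have := abs_reinner_le (T (u n) - w) (T y).
set a := reinner _ (T y); set b := reinner _ (T y) => ab hn dn'.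
have : 2 * t * a <= 2 * `|t| * normR (T y) * normR (T (u n) - w).
  have : t * a <= `|t| * (normR (T (u n) - w) * normR (T y)).
    by apply: le_trans (ler_norm _) _; rewrite normrM ler_wpM2l.
  lra.
have : 2 * `|t| * normR (T y) * normR (T (u n) - w) <= e / 2.
  apply: (@le_trans _ _ (K * normR (T (u n) - w))).
    by rewrite ler_wpM2r ?normR_ge0// /K lerDl.
  by rewrite -ler_pdivlMl// mulrC ltW.
move: (n.+1%:R^-1) h1 hn => r.
lra.
Qed.

End LinearOperator.

(** * First and second moments of measures on the real line *)

Section Moments.
Context {R : realType}.
Implicit Types mu : {measure set R -> \bar R}.

Lemma integrable_cst_fin mu (c : R) : (mu setT < +oo)%E ->
  mu.-integrable setT (EFin \o cst c).
Proof.
move=> fin; apply/integrableP; split; first exact/measurable_EFinP.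
by rewrite /= integral_cst// lte_mul_pinfty.
Qed.

(** Domination by [1 + t^2], which follows from [(|t| - 1)^2 >= 0]. *)
Lemma integrable_first_moment mu : (mu setT < +oo)%E ->
  (\int[mu]_t (t ^+ 2)%:E < +oo)%E -> mu.-integrable setT (EFin \o idfun).
Proof.
move=> fin0 fin2.
have intg : mu.-integrable setT (fun t => 1%:E + (t ^+ 2)%:E)%E.
  apply/integrableP; split.
    apply: emeasurable_funD => //; apply/measurable_EFinP.
    exact: measurable_funX.
  under eq_integral do rewrite gee0_abs ?adde_ge0 ?lee_fin ?sqr_ge0//.
  rewrite ge0_integralD//.
  + by rewrite integral_cst// mul1e lte_add_pinfty.
  + by move=> t _; rewrite lee_fin sqr_ge0.
  + by apply/measurable_EFinP; exact: measurable_funX.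
apply: le_integrable intg => //; first exact/measurable_EFinP/measurable_id.
move=> t _ /=; rewrite lee_fin [leRHS]ger0_norm ?addr_ge0 ?sqr_ge0//.
have := sqr_ge0 (`|t| - 1); rewrite sqrrB1 real_normK ?num_real// mulr2n.
by have := normr_ge0 t; lra.
Qed.

Lemma second_moment_add mu mu1 mu2 :
  (forall S, measurable S -> mu S = mu1 S + mu2 S)%E ->
  (\int[mu]_t (t ^+ 2)%:E =
   \int[mu1]_t (t ^+ 2)%:E + \int[mu2]_t (t ^+ 2)%:E)%E.
Proof.
move=> muD; rewrite -ge0_integral_measure_add//; last first.
- by apply/measurable_EFinP; exact: measurable_funX.
- by move=> t _; rewrite lee_fin sqr_ge0.
apply: eq_measure_integral => S mS _.
by rewrite muD//= -measure_addE.
Qed.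

Lemma first_moment_add mu mu1 mu2 :
  mu1.-integrable setT (EFin \o idfun) ->
  mu2.-integrable setT (EFin \o idfun) ->
  (forall S, measurable S -> mu S = mu1 S + mu2 S)%E ->
  \int[mu]_t t = \int[mu1]_t t + \int[mu2]_t t.
Proof.
move=> i1 i2 muD; rewrite /Rintegral.
rewrite (_ : (\int[mu]_t t%:E)%E =
  (\int[mu1]_t t%:E + \int[mu2]_t t%:E)%E); last first.
  rewrite -integral_measure_add//.
  apply: eq_measure_integral => S mS _.
  by rewrite muD//= -measure_addE.
by rewrite fineD//; exact: integrable_fin_num.
Qed.

Lemma Rintegral_ge_cst mu (S : set R) (f : R -> R) (c : R) : measurable S ->
  (mu setT < +oo)%E -> mu.-integrable setT (EFin \o f) -> mu (~` S) = 0 ->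
  (forall t, S t -> c <= f t) -> c * fine (mu setT) <= \int[mu]_t f t.
Proof.
move=> mS fin intf muS cf.
have intc := integrable_cst_fin c fin.
have mCS := measurableC mS.
rewrite -Rintegral_cst// /Rintegral.
rewrite (negligible_integral mCS _ intc)// (negligible_integral mCS _ intf)//.
rewrite setTD setCK.
have intcS : mu.-integrable S (EFin \o cst c) by exact: integrableS intc.
have intfS : mu.-integrable S (EFin \o f) by exact: integrableS intf.
apply: fine_le; try exact: integrable_fin_num.
apply: le_integral => // t; rewrite inE => St.
by rewrite lee_fin cf.
Qed.

End Moments.

(** * Spectral projections: commutation with the operator and the spectral gap *)

Section Spectral.
Context {R : realType} {X : hilbertType R} {A : operator X}.
Context {E : set R -> {linear X -> X}}.
Context (linA : linear_operator A) (specA : spectral_measure A E).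

Lemma pvmI S T x : measurable S -> measurable T -> E S (E T x) = E (S `&` T) x.
Proof. by case: specA => -[_ + _ _] _ mS mT => ->. Qed.

Lemma pvm_sym S x y : measurable S -> reinner (E S x) y = reinner x (E S y).
Proof. by case: specA => -[+ _ _ _] _ mS => /(_ _ mS x y); rewrite /reinner => ->. Qed.

Lemma pvmT x : E setT x = x.
Proof. by case: specA => -[]. Qed.

Lemma pvm_normR2 S x : measurable S -> reinner (E S x) x = normR (E S x) ^+ 2.
Proof. by move=> mS; rewrite normR2 [RHS]pvm_sym// pvmI// setIid reinnerC. Qed.

Lemma pvm0 x : E set0 x = 0.
Proof.
have [mu [muE _ _]] := specA.2 x.
have /eqP := muE _ measurable0; rewrite measure0 eqe eq_sym => /eqP.
rewrite -/(reinner _ _) pvm_normR2// => /eqP; rewrite sqrf_eq0 => /eqP.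
exact: normR0_eq0.
Qed.

Lemma pvm_setC_pythagoras S x : measurable S ->
  normR x ^+ 2 = normR (E S x) ^+ 2 + normR (E (~` S) x) ^+ 2.
Proof.
move=> mS; have mC := measurableC mS.
have [mu [muE _ _]] := specA.2 x.
have : mu setT = (mu S + mu (~` S))%E.
  by rewrite -measureU// ?setUCr// setICr.
rewrite !muE// -!/(reinner _ _) !pvm_normR2// pvmT -EFinD => /eqP.
by rewrite eqe => /eqP.
Qed.

(** Derived from norms: [u = x - E S x] satisfies [E S u = 0], so by Pythagoras its projection for
    the complement keeps its norm and therefore equals [u]. *)
Lemma pvm_setC S x : measurable S -> E (~` S) x = x - E S x.
Proof.
move=> mS; have mC := measurableC mS.
have CS : E (~` S) (E S x) = 0 by rewrite pvmI// setICl pvm0.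
have SS : E S (x - E S x) = 0 by rewrite linearB /= pvmI// setIid subrr.
apply/eqP; rewrite -subr_eq0; apply/eqP/normR0_eq0/eqP; rewrite -sqrf_eq0.
set u := x - E S x; have -> : E (~` S) x = E (~` S) u.
  by rewrite linearB /= CS subr0.
rewrite -normRN opprB normR_sqrD normRN reinnerNr reinnerC pvm_normR2//.
by rewrite (pvm_setC_pythagoras u mS) SS normR0; apply/eqP; ring.
Qed.

(** The middle projection [E T] is there for [pvm_split], where the spectral measure of a sum is
    evaluated on an arbitrary measurable [T]. *)
Lemma pvm_ortho S T U x y : measurable S -> measurable T -> measurable U ->
  S `&` U = set0 -> inner (E T (E S x)) (E U y) = 0.
Proof.
move=> mS mT mU SU.
have key z : reinner (E T (E S z)) (E U y) = 0.
  rewrite -pvm_sym// pvmI// pvmI//; last exact: measurableI.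
  by rewrite setIAC (setIC U) SU set0I pvm0 reinner0l.
by apply: inner_eq0; rewrite -?linearZ /= ?key// -linearZ /= -linearZ /= key.
Qed.

(** The cross terms of [E T] between [u] and [v] vanish, so the spectral measure of [u + v] is the
    sum of theirs. Additivity of the second moment gives the domains, that of the first moment gives
    the form. *)
Lemma pvm_split S x y : measurable S ->
  let u := E S x in let v := E (~` S) y in
  (dom A (u + v) <-> dom A u /\ dom A v) /\
  (dom A (u + v) -> inner (A (u + v)) (u + v) = inner (A u) u + inner (A v) v).
Proof.
move=> mS u v; have mC := measurableC mS.
have [m1 [m1E d1 i1]] := specA.2 u.
have [m2 [m2E d2 i2]] := specA.2 v.
have [m [mE d i]] := specA.2 (u + v).
have mD T : measurable T -> (m T = m1 T + m2 T)%E.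
  move=> mT; rewrite mE// m1E// m2E// -EFinD -!/(reinner _ _).
  rewrite linearD /= !reinnerDl !reinnerDr.
  have -> : reinner (E T u) v = 0 by rewrite /reinner pvm_ortho// setICr.
  have -> : reinner (E T v) u = 0 by rewrite /reinner pvm_ortho// setICl.
  by rewrite addr0 add0r.
have fin mu w : (forall T, measurable T -> mu T = (reinner (E T w) w)%:E) ->
    (mu setT < +oo)%E.
  by move=> ->//; rewrite ltry.
have pos (mu : {measure set R -> \bar R}) : (0 <= \int[mu]_t (t ^+ 2)%:E)%E.
  by apply: integral_ge0 => t _; rewrite lee_fin sqr_ge0.
have duv : dom A (u + v) <-> dom A u /\ dom A v.
  rewrite d d1 d2 (second_moment_add mD); split.
    by move=> f; split; apply: le_lt_trans f; rewrite ?leeDl ?leeDr.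
  by move=> [f1 f2]; rewrite lte_add_pinfty.
split=> // dw; have [du dv] := duv.1 dw.
rewrite i// i1// i2//.
have -> : \int[m]_t t = \int[m1]_t t + \int[m2]_t t.
  apply: first_moment_add => //.
  - by apply: integrable_first_moment; [exact: fin m1E|exact/d1].
  - by apply: integrable_first_moment; [exact: fin m2E|exact/d2].
by apply/eqP; rewrite eq_complex /= addr0 !eqxx.
Qed.

Lemma dom_pvm S x : measurable S -> dom A x -> dom A (E S x).
Proof.
move=> mS dx; have [duv _] := pvm_split x x mS.
by have [] : dom A (E S x) /\ dom A (E (~` S) x);
  first by apply/duv; rewrite pvm_setC// addrC subrK.
Qed.

(* The quadratic form x |-> <A x, x> is additive on u + v and on iu + v, so the
   cross terms a(u, v) + a(v, u) and a(u, v) - a(v, u) both vanish. *)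
Lemma pvm_form_ortho S x y : measurable S -> dom A (E S x) -> dom A (E (~` S) y) ->
  inner (A (E S x)) (E (~` S) y) = 0.
Proof.
move=> mS; have key z : dom A (E S z) -> dom A (E (~` S) y) ->
    inner (A (E S z)) (E (~` S) y) + inner (A (E (~` S) y)) (E S z) = 0.
  move=> du dv; have [duv /(_ (duv.2 (conj du dv)))] := pvm_split z y mS.
  have [_ ->] := linopD linA du dv.
  rewrite !innerDl !innerDr => /eqP; rewrite -subr_eq0 => /eqP <-.
  by ring.
move=> du dv; have k1 := key x du dv.
have [dZ AZ] := linopZ linA 'i du.
have : dom A (E S ('i *: x)) by rewrite linearZ.
move=> /key/(_ dv); rewrite linearZ /= AZ innerZl innerZr => k2.
move: k2; rewrite conjCi mulNr -mulrBr => /eqP; rewrite mulf_eq0 (negbTE (neq0Ci _)).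
rewrite /= subr_eq0 => /eqP e.
move: k1; rewrite -e -mulr2n => /eqP; rewrite mulrn_eq0 /= => /eqP.
by [].
Qed.

Context (densA : closure (dom A) = setT).

(** Pairing with the dense set [dom A] suffices: a projected vector of [dom A] stays in [dom A],
    where the form is orthogonal. *)
Lemma pvm_apply_range S x : measurable S -> dom A (E S x) ->
  E (~` S) (A (E S x)) = 0.
Proof.
move=> mS du; have mC := measurableC mS; apply: (dense_ortho densA) => y dy.
by rewrite pvm_sym// /reinner pvm_form_ortho//; exact: dom_pvm.
Qed.

Lemma pvm_commute S x : measurable S -> dom A x -> E S (A x) = A (E S x).
Proof.
move=> mS dx; have mC := measurableC mS.
have du := dom_pvm mS dx; have dv := dom_pvm mC dx.
have -> : A x = A (E S x) + A (E (~` S) x).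
  have [_ <-] := linopD linA du dv.
  by rewrite pvm_setC// addrC subrK.
have := pvm_apply_range mC dv; rewrite setCK linearD /= => ->.
have := pvm_apply_range mS du; rewrite pvm_setC// => /eqP.
by rewrite subr_eq0 addr0 => /eqP <-.
Qed.

(* The sign e = 1 or -1 selects a half-line to the right or to the left of s. *)
Lemma half_line_bound (S : set R) (s r e : R) x : measurable S -> dom A x ->
  e ^+ 2 = 1 -> (forall t, S t -> r <= e * (t - s)) ->
  r * normR (E S x) <= normR (A (E S x) - s*i *: E S x).
Proof.
move=> mS dx e1 Sr; set u := E S x.
have du : dom A u by exact: dom_pvm.
have [mu [muE dmu imu]] := specA.2 u.
have finmu : (mu setT < +oo)%E by rewrite muE// ltry.
have intmu : mu.-integrable setT (EFin \o idfun).
  by apply: integrable_first_moment => //; exact/dmu.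
(* [E S] fixes [u], so the spectral measure of [u] is concentrated on [S]. *)
have muCS : mu (~` S) = 0.
  rewrite muE//; last exact: measurableC.
  by rewrite /u pvmI//; [rewrite setICl pvm0 inner0l|exact: measurableC].
have muT : fine (mu setT) = normR u ^+ 2 by rewrite muE// pvmT normR2.
have intf : mu.-integrable setT (EFin \o (fun t => e * t)).
  by apply: eq_integrable (integrableZl measurableT e intmu).
(* Integrating [e * t >= r + e * s] over [S] gives [(r + e s) |u|^2 <= e Im <A u, u>]. *)
have := @Rintegral_ge_cst _ mu S (fun t => e * t) (r + e * s) mS finmu intf muCS.
have ee t : S t -> r + e * s <= e * t by move=> /Sr; lra.
move=> /(_ ee); rewrite RintegralZl// muT.
have -> : \int[mu]_t t = complex.Im (inner (A u) u) by rewrite imu.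
move=> h; have [u0|u0] := eqVneq (normR u) 0.
  by rewrite u0 mulr0 normR_ge0.
have up : 0 < normR u by rewrite lt_def u0 normR_ge0.
rewrite -(ler_pM2r up) -mulrA -expr2.
apply: (@le_trans _ _ (e * complex.Im (inner (A u - s*i *: u) u))).
  rewrite innerDl innerNl innerZl innerxx.
  have -> : complex.Im (inner (A u) u - s*i * (normR u ^+ 2)%:C) =
     complex.Im (inner (A u) u) - s * normR u ^+ 2.
    by case: (inner (A u) u) => a b /=; rewrite mul0r add0r.
  by lra.
(* [e Im <w, u>] is the real inner product of [u] with a unimodular multiple of [w], so
   Cauchy-Schwarz bounds it by [|w| |u|]. *)
set w := A u - _.
have -> : complex.Im (inner w u) = - reinner ('i *: w) u.
  by rewrite reinner_iZl opprK.
have -> : e * - reinner ('i *: w) u = reinner ((- e)%:C *: ('i *: w)) u.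
  by rewrite reinnerZl; ring.
apply: le_trans (reinner_le _ _) _; rewrite ler_wpM2r ?normR_ge0//.
rewrite !normRZ.
have -> : complex.Re `|(- e)%:C| = 1.
  by rewrite normc_def /= expr0n addr0 sqrrN e1 sqrtr1.
by rewrite normc_def /= expr0n expr1n add0r sqrtr1 !mul1r.
Qed.

(** On the whole complement [t - s] changes sign and the first moment could cancel. It is therefore
    cut into the half-lines [t >= s + r] and [t <= s - r], and the squares of the two bounds are
    added. *)
Lemma spectral_gap (s r : R) x : 0 < r -> dom A x ->
  r * normR (E (~` `]s - r, s + r[) x) <=
  normR (E (~` `]s - r, s + r[) (A x - s*i *: x)).
Proof.
move=> r0 dx; set S := [set` `]s - r, s + r[]; pose Q := E (~` S).
rewrite -/Q.
have mS : measurable S by exact: measurable_itv.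
have mC := measurableC mS.
have AQ T z : measurable T -> dom A z ->
    E T (A z - s*i *: z) = A (E T z) - s*i *: E T z.
  by move=> mT dz; rewrite linearB linearZ /= pvm_commute.
pose T : set R := `[s + r, +oo[%classic.
have mT : measurable T by exact: measurable_itv.
have mCT := measurableC mT.
have TS z : E T (Q z) = E T z.
  rewrite /Q pvmI//; congr (E _ _); apply/seteqP; split=> [t []//|t Tt].
  split=> //; move: Tt; rewrite /T /S /= !in_itv /= => h /andP[_].
  by move: h; rewrite andbT leNgt => /negP.
have bT : r * normR (E T x) <= normR (E T (A x - s*i *: x)).
  rewrite AQ//; apply: (@half_line_bound _ _ _ 1) => //; first by rewrite expr1n.
  by move=> t; rewrite /T /= in_itv /= andbT; lra.
have CTS z : E (~` T) (Q z) = E (~` T `&` ~` S) z by rewrite /Q pvmI.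
have mCTS : measurable (~` T `&` ~` S) by exact: measurableI.
have bC : r * normR (E (~` T) (Q x)) <= normR (E (~` T) (Q (A x - s*i *: x))).
  rewrite !CTS AQ//; apply: (@half_line_bound _ _ _ (-1)) => //.
    by rewrite sqrrN expr1n.
  move=> t; rewrite /T /S /= !in_itv /= andbT => -[/negP + /negP].
  by rewrite -ltNge => tr; rewrite tr andbT -leNgt; lra.
rewrite -ler_sqr ?nnegrE ?mulr_ge0 ?normR_ge0 ?(ltW r0)//.
rewrite exprMn (pvm_setC_pythagoras (Q x) mT).
rewrite (pvm_setC_pythagoras (Q (A x - s*i *: x)) mT) mulrDr -!exprMn !TS.
by apply: lerD; rewrite ler_sqr ?nnegrE ?mulr_ge0 ?normR_ge0 ?(ltW r0).
Qed.

End Spectral.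

(** * The scalar inequality behind the constant [const_MR] *)

(** [N], [Y], [m], [p], [q] stand for the norms of [x], [T x], [D^* x], [P x], [Q x]. The squared
    hypotheses give a quadratic inequality for [W = eta^2 delta^2 N]; completing the square solves
    it, and the resulting [K] grows with [eta] and [delta], so [eta0] and [delta0] may replace
    them. *)
Lemma const_MR_bound (R : realType) (N Y m p q d eta delta eta0 delta0 : R) :
  0 <= N -> 0 <= Y -> 0 <= m -> 0 <= p -> 0 <= q -> 0 <= d ->
  0 < eta <= eta0 -> 0 < delta <= delta0 ->
  m ^+ 2 <= Y * N -> delta * q <= Y + d * m -> eta * p <= m + d * q ->
  N ^+ 2 = p ^+ 2 + q ^+ 2 ->
  N <= const_MR eta0 delta0 d / (eta ^+ 2 * delta ^+ 2) * Y.
Proof.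
move=> N0 Y0 m0 p0 q0 d0 /andP[eta_gt0 eta_le] /andP[delta_gt0 delta_le].
move=> mYN dq ep Npq.
have sq2 (x y z : R) : 0 <= x -> x <= y + z -> x ^+ 2 <= 2 * (y ^+ 2 + z ^+ 2).
  move=> x0 xyz; apply: (@le_trans _ _ ((y + z) ^+ 2)).
    by rewrite ler_sqr ?nnegrE// (le_trans x0).
  by have := sqr_ge0 (y - z); rewrite sqrrB sqrrD !mulr2n; lra.
have hq := sq2 _ _ _ (mulr_ge0 (ltW delta_gt0) q0) dq.
have hp := sq2 _ _ _ (mulr_ge0 (ltW eta_gt0) p0) ep.
rewrite !exprMn in hq hp.
have e_gt0 : 0 < eta ^+ 2 by rewrite exprn_gt0.
have f_gt0 : 0 < delta ^+ 2 by rewrite exprn_gt0.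
have e_le : eta ^+ 2 <= eta0 ^+ 2.
  by rewrite ler_sqr ?nnegrE ?(ltW eta_gt0) ?(le_trans (ltW eta_gt0) eta_le).
have f_le : delta ^+ 2 <= delta0 ^+ 2.
  by rewrite ler_sqr ?nnegrE ?(ltW delta_gt0) ?(le_trans (ltW delta_gt0) delta_le).
rewrite /const_MR.
rewrite (_ : eta0 ^+ 4 = (eta0 ^+ 2) ^+ 2); last by rewrite -exprM.
rewrite (_ : d ^+ 4 = (d ^+ 2) ^+ 2); last by rewrite -exprM.
have D_ge0 : 0 <= d ^+ 2 by rewrite sqr_ge0.
(* From here [e], [f], [e0], [f0], [D] are the squares of [eta], [delta], [eta0], [delta0], [d]. *)
move: (eta ^+ 2) (delta ^+ 2) (eta0 ^+ 2) (delta0 ^+ 2) (d ^+ 2) e_gt0 f_gt0 e_le f_le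
  D_ge0 hq hp => e f e0 f0 D e_gt0 f_gt0 e_le f_le D_ge0 hq hp.
have ef_gt0 : 0 < e * f by rewrite mulr_gt0.
have Dm : D * m ^+ 2 <= D * (Y * N) by rewrite ler_wpM2l.
have hq' : f * q ^+ 2 <= 2 * (Y ^+ 2 + D * (Y * N)) by lra.
have hp' : e * p ^+ 2 <= 2 * (Y * N + D * q ^+ 2) by lra.
pose W := e * f * N.
have W0 : 0 <= W by rewrite mulr_ge0// ltW.
pose b := f + e * D + 2 * D ^+ 2.
(* After [N^2 = p^2 + q^2], [hp'] removes [p]; the terms in [q] then add up to [(2 D + e) f q^2],
   which [hq'] bounds. *)
have WN : W * N <= 2 * b * (Y * N) + 2 * (2 * D + e) * Y ^+ 2.
  have -> : W * N = f * (e * p ^+ 2) + e * (f * q ^+ 2).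
    by rewrite /W -mulrA -expr2 Npq; ring.
  have h1 := ler_wpM2l (ltW f_gt0) hp'.
  have De : 0 <= 2 * D + e by lra.
  have h2 := ler_wpM2l De hq'.
  rewrite /b; lra.
have WW : W ^+ 2 <= 2 * b * Y * W + 2 * (2 * D + e) * (e * f) * Y ^+ 2.
  by have := ler_wpM2l (ltW ef_gt0) WN; rewrite /W; lra.
pose K := e ^+ 2 * f + 2 * e * f * D + b ^+ 2.
have WK : W ^+ 2 <= 4 * K * Y ^+ 2.
  (* [2 b Y W <= W^2 / 2 + 2 b^2 Y^2] absorbs the linear term; doubling produces the factor 4. *)
  have := sqr_ge0 (W - 2 * b * Y); rewrite sqrrB mulr2n /K => ?.
  by move: WW; lra.
pose K0 := e0 ^+ 2 * f0 + 2 * e0 * f0 * D + (f0 + e0 * D + 2 * D ^+ 2) ^+ 2.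
have b_ge0 : 0 <= b.
  by rewrite /b; have := mulr_ge0 (ltW e_gt0) D_ge0; have := sqr_ge0 D; lra.
have K0_ge0 : 0 <= K0.
  have e00 : 0 <= e0 by apply: le_trans e_le; exact: ltW.
  have f00 : 0 <= f0 by apply: le_trans f_le; exact: ltW.
  by rewrite /K0 !addr_ge0 ?sqr_ge0// ?mulr_ge0 ?exprn_ge0.
have KK0 : K <= K0.
  have ee : e * f <= e0 * f0 by rewrite ler_pM// ltW.
  have eD : e * D <= e0 * D by rewrite ler_wpM2r.
  rewrite /K /K0; apply: lerD; first apply: lerD.
  - apply: ler_pM => //; rewrite ?sqr_ge0 ?(ltW f_gt0)//.
    by rewrite ler_sqr ?nnegrE ?(le_trans (ltW e_gt0))// ltW.
  - by have := ler_wpM2r D_ge0 ee; lra.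
  - rewrite ler_sqr ?nnegrE//; first by rewrite /b; lra.
    by apply: le_trans b_ge0 _; rewrite /b; lra.
rewrite mulrAC ler_pdivlMr// mulrC -/K0.
have -> : 2 * Num.sqrt K0 * Y = Num.sqrt (4 * K0 * Y ^+ 2).
  rewrite sqrtrM ?mulr_ge0// sqrtr_sqr ger0_norm// sqrtrM//.
  by rewrite (_ : 4 = 2 ^+ 2 :> R) ?sqrtr_sqr ?ger0_norm// -natrX.
rewrite -/W -(ger0_norm W0) -sqrtr_sqr ler_sqrt.
  by apply: le_trans WK _; rewrite ler_wpM2r ?sqr_ge0// ler_wpM2l.
by rewrite !mulr_ge0 ?sqr_ge0.
Qed.

(** * Inverses of partially defined operators *)

Section Inverse.
Context {R : realType} {X : hilbertType R} {T : operator X}.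

Lemma op_inv_spec y : (exists x, dom T x /\ T x = y) ->
  dom T (op_inv T y) /\ T (op_inv T y) = y.
Proof.
by move=> [x Txy]; exact: (@xgetPex _ 0 [set x | dom T x /\ T x = y] (ex_intro _ x Txy)).
Qed.

Context (linT : linear_operator T).
Context (injT : forall x, dom T x -> T x = 0 -> x = 0).

Lemma op_inv_eq x y : dom T x -> T x = y -> op_inv T y = x.
Proof.
move=> dx Tx; have [dy Ty] := op_inv_spec (ex_intro _ x (conj dx Tx)).
have [dB TB] := linopB linT dy dx.
by apply/eqP; rewrite -subr_eq0; apply/eqP/injT => //; rewrite TB Ty Tx subrr.
Qed.

Context (surjT : forall y, exists x, dom T x /\ T x = y).

Lemma op_invP y : dom T (op_inv T y) /\ T (op_inv T y) = y.
Proof. exact: op_inv_spec. Qed.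

Lemma op_invZ a x : op_inv T (a *: x) = a *: op_inv T x.
Proof.
have [dx Tx] := op_invP x.
by have [d e] := linopZ linT a dx; apply: op_inv_eq; rewrite // e Tx.
Qed.

End Inverse.

(** * Skew-adjoint operators: a domain criterion and closedness *)

Section SkewAdjoint.
Context {R : realType} {X : hilbertType R} {A0 : operator X}.
Context (skewA0 : skew_adjoint A0).

Lemma skew_reinner x y : dom A0 x -> dom A0 y ->
  reinner (A0 x) y = - reinner x (A0 y).
Proof.
move=> dx dy; have [_ _ adj] := skewA0.
have /(_ _ dx) h := (adj y (- A0 y)).2 (conj dy erefl).
by rewrite -reinnerNr /reinner h.
Qed.

Lemma skew_reinner_diag x : dom A0 x -> reinner (A0 x) x = 0.
Proof. by move=> dx; have := skew_reinner dx dx; rewrite (reinnerC (A0 x) x); lra. Qed.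

(** Real parts suffice because ['i *: x] supplies the imaginary part; skew-adjointness then places
    the adjoint's domain in [dom A0]. *)
Lemma skew_domP y z : (forall x, dom A0 x -> reinner (A0 x) y = reinner x z) ->
  dom A0 y /\ A0 y = - z.
Proof.
move=> h; have [lin _ adj] := skewA0.
suff /adj[dy zE] : adjoint_graph A0 y z by split=> //; rewrite zE opprK.
move=> x dx; apply/eqP; rewrite -subr_eq0 -innerNr; apply/eqP.
have rr w : dom A0 w -> reinner (A0 w) y - reinner w z = 0.
  by move=> /h ->; rewrite subrr.
have [dix ix] := linopZ lin 'i%C dx.
apply/eqP; rewrite innerNr eq_complex !raddfB /=; apply/andP; split; apply/eqP.
  exact: rr.
by have := rr _ dix; rewrite ix !reinner_iZl; lra.
Qed.

(** For fixed [w], the identity [Re <A0 w, u n> = - Re <w, A0 (u n)>] passes to the limit, which is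
    the criterion of [skew_domP]. *)
Lemma skew_closed : closed_operator A0.
Proof.
move=> u x y du ux uy.
suff [] : dom A0 x /\ A0 x = - - y by rewrite opprK.
apply: skew_domP => w dw; rewrite reinnerNr.
apply/eqP; rewrite -subr_eq0 opprK -normr_le0; apply/ler_addgt0Pr => e e0.
rewrite add0r.
pose K := normR (A0 w) + normR w + 1.
have K0 : 0 < K by rewrite ltr_pwDr// addr_ge0 ?normR_ge0.
have [N1 h1] := ux _ (divr_gt0 e0 K0); have [N2 h2] := uy _ (divr_gt0 e0 K0).
pose n := maxn N1 N2.
have {}h1 := h1 n (leq_maxl _ _); have {}h2 := h2 n (leq_maxr _ _).
have -> : reinner (A0 w) x + reinner w y =
    reinner (A0 w) (x - u n) + reinner w (y - A0 (u n)).
  by rewrite !reinnerDr !reinnerNr (skew_reinner dw (du n)); ring.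
apply: le_trans (ler_normD _ _) _.
apply: le_trans (lerD (abs_reinner_le _ _) (abs_reinner_le _ _)) _.
rewrite normRB (normRB y).
apply: (@le_trans _ _ ((normR (A0 w) + normR w) * (e / K))).
  by rewrite mulrDl; apply: lerD; rewrite ler_wpM2l ?normR_ge0// ltW.
rewrite mulrCA ler_piMr ?(ltW e0)// ler_pdivrMr// mul1r.
by rewrite /K lerDl.
Qed.

End SkewAdjoint.

Lemma shift_linear (R : realType) (X : hilbertType R) (A : operator X) lambda :
  linear_operator A -> linear_operator (op_shift lambda (op_opp A)).
Proof.
move=> linA; split=> [|a x y dx dy]; first exact: linA.1.
have [dxy e] := linA.2 a x y dx dy; split=> //=.
by rewrite e scalerDr opprD addrACA [a *: (lambda *: x - _)]scalerBr !scalerA mulrC.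
Qed.

(** * The damped operator: dissipativity and closedness of its shifts *)

Section Damped.
Context {R : realType} {X U : hilbertType R} {A0 : operator X}.
Context {D : {linear U -> X}} {Ds : {linear X -> U}}.
Context (skewA0 : skew_adjoint A0) (contD : continuous D)
  (adjD : is_adjoint D Ds).

Let d := fine (opnorm D).
Let A := damped A0 D Ds.
Let T (lambda : R[i]) : operator X := op_shift lambda (op_opp A).

Lemma opnormD_ge0 : 0 <= d.
Proof. exact/fine_ge0/opnorm_ge0. Qed.

Lemma normRD_le u : normR (D u) <= d * normR u.
Proof.
have [M [M0 DM]] := continuous_normR_bounded contD.
apply: (opnorm_bound (M := M)) => [a x|x x1]; first exact: linearZ.
by apply: le_trans (DM x) _; rewrite ler_piMr.
Qed.

Lemma reinner_DDs x y : reinner (D (Ds x)) y = reinner (Ds x) (Ds y).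
Proof. by rewrite /reinner adjD. Qed.

(** Divide [|D^* x|^2 = Re <D D^* x, x> <= |D| |D^* x| |x|] by [|D^* x|]. *)
Lemma normRDs_le x : normR (Ds x) <= d * normR x.
Proof.
have [->|x0] := eqVneq (normR (Ds x)) 0.
  by rewrite mulr_ge0 ?normR_ge0 ?opnormD_ge0.
have xp : 0 < normR (Ds x) by rewrite lt_def x0 normR_ge0.
rewrite -(ler_pM2l xp) -expr2 normR2 -reinner_DDs.
apply: le_trans (reinner_le _ _) _; rewrite mulrA ler_wpM2r ?normR_ge0//.
by rewrite mulrC normRD_le.
Qed.

Lemma damped_linear : linear_operator A.
Proof.
have [lin _ _] := skewA0; split=> [|a x y dx dy]; first exact: lin.1.
have [dxy e] := lin.2 a x y dx dy; split=> //=.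
by rewrite e (linearP Ds) (linearP D) scalerBr opprD addrACA.
Qed.

Lemma damped_dissipative x : dom A x -> reinner (A x) x = - normR (Ds x) ^+ 2.
Proof.
move=> dx; rewrite /= reinnerDl reinnerNl (skew_reinner_diag skewA0 dx).
by rewrite reinner_DDs normR2 add0r.
Qed.

(** The real part of [<(lambda - A) x, x>] is [Re lambda |x|^2 + |D^* x|^2], and Cauchy-Schwarz
    bounds it from above. *)
Lemma shift_bounded_below lambda x : dom A x ->
  complex.Re lambda * normR x <= normR (T lambda x).
Proof.
move=> dx; have [->|x0] := eqVneq (normR x) 0; first by rewrite mulr0 normR_ge0.
have xp : 0 < normR x by rewrite lt_def x0 normR_ge0.
rewrite -(ler_pM2r xp) -mulrA -expr2; apply: le_trans (reinner_le _ _).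
rewrite /T [(op_shift _ _) x]/= reinnerDl reinnerNl.
rewrite [reinner (A0 x - _) x](damped_dissipative dx).
have -> : reinner (lambda *: x) x = complex.Re lambda * normR x ^+ 2.
  by rewrite /reinner innerZl innerxx mulrC ReZ mulrC.
by have := sqr_ge0 (normR (Ds x)); lra.
Qed.

(** A bounded perturbation of the closed [A0]: [A0 (u n)] is recovered from [T lambda (u n)] and
    terms Lipschitz in [u n]. *)
Lemma shift_closed lambda : closed_operator (T lambda).
Proof.
move=> u x y du ux uy.
pose w := lambda *: x + D (Ds x) - y.
have Tw : tends (A0 \o u) w.
  have -> : A0 \o u = fun n => (lambda *: u n + D (Ds (u n))) - T lambda (u n).
    by apply/funext => n /=; rewrite opprB addrC addrA subrK subrK.
  apply: tendsD; first apply: tendsD.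
  - apply: (tends_lipschitz (M := complex.Re `|lambda|)) ux => a b.
    by rewrite -scalerBr normRZ.
  - apply: (tends_lipschitz (f := D \o Ds) (M := d * d)) ux => a b /=.
    rewrite -!linearB /= -mulrA; apply: le_trans (normRD_le _) _.
    by rewrite ler_wpM2l ?opnormD_ge0 ?normRDs_le.
  - apply: (tends_lipschitz (f := -%R) (M := 1)) uy => a b.
    by rewrite -opprD normRN mul1r.
have [dx A0x] := skew_closed skewA0 du ux Tw.
split=> //; rewrite /T /= A0x /w addrAC addrK opprB addrC subrK.
by [].
Qed.

End Damped.

(** * Resolvent bound and surjectivity on the imaginary axis *)

Section DampedResolvent.
Context {R : realType} {X U : hilbertType R} {A0 : operator X}.
Context {D : {linear U -> X}} {Ds : {linear X -> U}}.
Context (skewA0 : skew_adjoint A0) (contD : continuous D)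
  (adjD : is_adjoint D Ds).

Let d := fine (opnorm D).
Let A := damped A0 D Ds.
Let T (lambda : R[i]) : operator X := op_shift lambda (op_opp A).

Lemma damped_estimate (s eta delta eta0 delta0 : R) (P : {linear X -> X}) x :
  0 < eta <= eta0 -> 0 < delta <= delta0 ->
  spectral_projection A0 (s - delta) (s + delta) P ->
  (forall x, range P x -> eta * normR x <= normR (Ds x)) ->
  dom A0 x ->
  normR x <= const_MR eta0 delta0 d / (eta ^+ 2 * delta ^+ 2) * normR (T (s*i) x).
Proof.
move=> etab deltab [E spec PE] obs dx; have [linA0 dens _] := skewA0.
have mS : measurable [set` `]s - delta, s + delta[] by exact: measurable_itv.
have mC := measurableC mS; set S := [set` _] in mS mC PE.
have delta_gt0 : 0 < delta by case/andP: deltab.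
have xE : x = P x + E (~` S) x by rewrite PE (pvm_setC spec)// addrC subrK.
have pyth : normR x ^+ 2 = normR (P x) ^+ 2 + normR (E (~` S) x) ^+ 2.
  by rewrite PE; exact: (pvm_setC_pythagoras spec x mS).
(* The goals that remain are dissipativity, the spectral gap and observability, in this order. *)
apply: (const_MR_bound (m := normR (Ds x)) (p := normR (P x))
  (q := normR (E (~` S) x)) _ _ _ _ _ _ etab deltab _ _ _ pyth);
  rewrite ?normR_ge0 ?opnormD_ge0//.
- have <- : reinner (T (s*i) x) x = normR (Ds x) ^+ 2.
    change (reinner (s*i *: x - A x) x = normR (Ds x) ^+ 2).
    rewrite reinnerDl reinnerNl (damped_dissipative skewA0 adjD)// opprK.
    by rewrite /reinner innerZl innerxx mulrC ReZ /= mulr0 add0r.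
  exact: reinner_le.
- apply: le_trans (spectral_gap linA0 spec dens s delta_gt0 dx) _.
  have contr z : normR (E (~` S) z) <= normR z.
    rewrite -ler_sqr ?nnegrE ?normR_ge0// (pvm_setC_pythagoras spec z mS).
    by rewrite lerDr sqr_ge0.
  apply: le_trans (contr _) _.
  have -> : A0 x - s*i *: x = - (T (s*i) x) + D (Ds x).
    by rewrite /T /= opprB addrAC subrK.
  apply: le_trans (normR_triangle _ _) _; rewrite normRN lerD2l.
  exact: normRD_le.
- apply: le_trans (obs _ _) _; first by exists x.
  have -> : P x = x - E (~` S) x by rewrite {2}xE addrK.
  rewrite linearB /=; apply: le_trans (normR_triangle _ _) _.
  by rewrite normRN lerD2l normRDs_le.
Qed.

(** If [y] is orthogonal to the range, then [y] lies in [dom A0] and [A0 y = is y - D D^* y].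
    Pairing with [y] removes the skew terms and leaves [D^* y = 0], so [T] kills [y] and the lower
    bound forces [y = 0]. *)
Lemma damped_shift_surjective (s M : R) : 0 < M ->
  (forall x, dom A0 x -> normR x <= M * normR (T (s*i) x)) ->
  forall z, exists x, dom A x /\ T (s*i) x = z.
Proof.
move=> M0 bT; have linT := shift_linear (s*i) (damped_linear skewA0 (D := D) (Ds := Ds)).
have Mi : 0 < M^-1 by rewrite invr_gt0.
have clT := shift_closed skewA0 contD adjD (lambda := s*i).
have bT' x : dom (T (s*i)) x -> M^-1 * normR x <= normR (T (s*i) x).
  by move=> dx; rewrite ler_pdivrMl// bT.
suff oT : forall y, (forall x, dom (T (s*i)) x -> reinner (T (s*i) x) y = 0) -> y = 0.
  by have := bounded_below_surjective linT Mi clT; move=> /(_ bT' oT).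
move=> y oy.
have iZ (x : X) : reinner (s*i *: x) y = reinner x (- (s*i *: y)).
  rewrite reinnerNr /reinner innerZl innerZr.
  by case: (inner x y) => a b /=; ring.
have [dy A0y] : dom A0 y /\ A0 y = - (D (Ds y) - s*i *: y).
  apply: (skew_domP skewA0) => x dx.
  have := oy x dx; rewrite /T /= !reinnerDl !reinnerNl reinnerDl reinnerNl.
  rewrite iZ reinnerDr (reinnerC (D _) x) (reinner_DDs adjD y x).
  by rewrite (reinner_DDs adjD x y) (reinnerC (Ds x)); lra.
have Dsy : Ds y = 0.
  apply: normR0_eq0; apply/eqP; rewrite -sqrf_eq0; apply/eqP.
  have := skew_reinner_diag skewA0 dy.
  rewrite A0y reinnerNl reinnerDl (reinner_DDs adjD) reinnerNl iZ -normR2.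
  have : reinner y (s*i *: y) = 0.
    rewrite /reinner innerZr innerxx mulrC ReZ /=.
    by rewrite mulr0.
  by rewrite reinnerNr => ->; lra.
have Ty : T (s*i) y = 0.
  by rewrite /T /= A0y Dsy linear0 sub0r opprK subr0 subrr.
apply: normR0_eq0; apply: le_anti; rewrite normR_ge0 andbT.
by have := bT y dy; rewrite Ty normR0 mulr0.
Qed.

End DampedResolvent.

(** * Resolvents applied to powers of the inverse, on the axis and in the right half-plane *)

Section ResolventPowers.
Context {R : realType} {X : hilbertType R} {A : operator X}.
Let T (lambda : R[i]) : operator X := op_shift lambda (op_opp A).
Let B := op_inv (op_opp A).

Context (linA : linear_operator A).
Context (disA : forall lambda x, dom A x ->
  complex.Re lambda * normR x <= normR (T lambda x)).
Context {M : R -> R}.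
Context (M_ge0 : forall s, 0 <= M s).
Context (boundT : forall s x, dom A x -> normR x <= M s * normR (T (s*i) x)).
Context (surjT : forall s z, exists x, dom A x /\ T (s*i) x = z).

Lemma shift_injective s x : dom A x -> T (s*i) x = 0 -> x = 0.
Proof.
move=> dx Tx; apply: normR0_eq0; apply: le_anti; rewrite normR_ge0 andbT.
by have := boundT s dx; rewrite Tx normR0 mulr0.
Qed.

Lemma resolvent_spec s y :
  dom A (resolvent (s*i) A y) /\ T (s*i) (resolvent (s*i) A y) = y.
Proof. exact: (op_inv_spec (T := T (s*i)) (surjT s y)). Qed.

Lemma normR_resolvent s y : normR (resolvent (s*i) A y) <= M s * normR y.
Proof. by have [dr Tr] := resolvent_spec s y; rewrite -{2}Tr; exact: boundT. Qed.

Lemma resolvent_eq s x y : dom A x -> T (s*i) x = y -> resolvent (s*i) A y = x.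
Proof.
move=> dx Tx.
exact: (op_inv_eq (shift_linear _ linA) (@shift_injective s) dx Tx).
Qed.

Lemma resolvent_set_imaginary s : resolvent_set A (s*i).
Proof.
split=> [y|].
  have [x [dx Tx]] := surjT s y; exists x; split=> // z [dz Tz].
  by rewrite -(resolvent_eq dx Tx); exact: (resolvent_eq dz Tz).
apply: (lipschitz_continuous (M := M s)) => x y.
have [dx Tx] := resolvent_spec s x; have [dy Ty] := resolvent_spec s y.
have [dB TB] := linopB (shift_linear (s*i) linA) dx dy.
by apply: le_trans (boundT s dB) _; rewrite TB -[in X in _ <= X]Tx -[in X in _ <= X]Ty.
Qed.

(** Identifies [B] with the resolvent at [s = 0], so the axis bounds apply to it. *)
Lemma shift0E : T (0*i) = op_opp A.
Proof.
rewrite /T /op_shift; congr Operator; apply/funext => x /=.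
by rewrite (_ : 0*i = 0)// scale0r add0r.
Qed.

Lemma neg_inv_spec u : dom A (B u) /\ A (B u) = - u.
Proof.
have := resolvent_spec 0 u; rewrite /resolvent -/(T _) shift0E => -[dB BE].
by split=> //; rewrite -[in RHS]BE /= opprK.
Qed.

Lemma op_inv_opp u : op_inv A u = - B u.
Proof.
have [dB AB] := neg_inv_spec u; have [dN AN] := linopN linA dB.
apply: op_inv_eq => //; last by rewrite AN AB opprK.
move=> x dx Ax; apply: (@shift_injective 0) => //.
by rewrite shift0E /= Ax oppr0.
Qed.

Let a := fine (opnorm (op_inv A)).

Lemma normR_neg_inv u : normR (B u) <= a * normR u.
Proof.
have injA x : dom A x -> A x = 0 -> x = 0.
  by move=> dx Ax; apply: (@shift_injective 0) => //; rewrite shift0E /= Ax oppr0.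
have surjA y : exists x, dom A x /\ A x = y.
  by have [dB AB] := neg_inv_spec (- y); exists (B (- y)); rewrite AB opprK.
rewrite -normRN -op_inv_opp; apply: (opnorm_bound (M := M 0)) => [c x|x x1].
  exact: op_invZ.
rewrite op_inv_opp normRN; apply: le_trans (_ : _ <= M 0 * normR x) _.
  have := normR_resolvent 0 x.
  by rewrite /resolvent -/(T _) shift0E.
by rewrite ler_piMr.
Qed.

Lemma op_inv_norm_ge0 : 0 <= a.
Proof. exact/fine_ge0/opnorm_ge0. Qed.

Lemma normR_iter_neg_inv n u : normR (iter n B u) <= a ^+ n * normR u.
Proof.
elim: n => [|n IH]; first by rewrite expr0 mul1r.
rewrite iterS; apply: le_trans (normR_neg_inv _) _.
by rewrite exprS -mulrA ler_wpM2l ?op_inv_norm_ge0.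
Qed.

(** Since [A (B u) = - u], the operator [is - A] sends [B u - R(is) u] to [is B u]. *)
Lemma resolvent_neg_inv s u : s != 0 ->
  resolvent (s*i) A (B u) = (s*i)^-1 *: (B u - resolvent (s*i) A u).
Proof.
move=> s0; have si0 : s*i != 0 by rewrite eq_complex /= (negbTE s0) andbF.
have [dB AB] := neg_inv_spec u; have [dr Tr] := resolvent_spec s u.
have linT := shift_linear (s*i) linA.
have [dBr TBr] := linopB linT dB dr; have [dZ TZ] := linopZ linT (s*i)^-1 dBr.
apply: resolvent_eq => //; rewrite TZ TBr Tr.
by rewrite /T /= AB opprK addrK scalerA mulVf// scale1r.
Qed.

(** Each use of [resolvent_neg_inv] divides the previous bound by [|s|] and adds [a^(n+1) / |s|],
    the new summand [k = n + 1]. *)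
Lemma normR_resolvent_iter s n u : s != 0 ->
  normR (resolvent (s*i) A (iter n B u)) <=
  (M s / `|s| ^+ n + \sum_(1 <= k < n.+1) a ^+ k / `|s| ^+ (n.+1 - k)) * normR u.
Proof.
move=> s0; have sp : 0 < `|s| by rewrite normr_gt0.
elim: n => [|n IH].
  by rewrite big_geq// addr0 expr0 divr1 normR_resolvent.
rewrite iterS resolvent_neg_inv// normRZ.
have -> : complex.Re `|(s*i)^-1| = `|s|^-1.
  by rewrite normrV ?normc_def ?expr0n ?add0r ?sqrtr_sqr -?fmorphV//=;
    rewrite unitfE eq_complex /= (negbTE s0) andbF.
rewrite -iterS.
have h : normR (iter n.+1 B u - resolvent (s*i) A (iter n B u)) <=
    a ^+ n.+1 * normR u +
    (M s / `|s| ^+ n + \sum_(1 <= k < n.+1) a ^+ k / `|s| ^+ (n.+1 - k)) * normR u.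
  apply: le_trans (normR_triangle _ _) _; rewrite normRN.
  by apply: lerD IH; exact: normR_iter_neg_inv.
have is0 : 0 <= `|s|^-1 by rewrite invr_ge0.
apply: le_trans (ler_wpM2l is0 h) _; rewrite -mulrDl mulrA ler_wpM2r ?normR_ge0//.
rewrite [in leRHS]big_nat_recr//= subSnn expr1 mulrDr mulrDr mulr_sumr.
rewrite (_ : \sum_(1 <= k < n.+1) `|s|^-1 * _ =
    \sum_(1 <= k < n.+1) a ^+ k / `|s| ^+ (n.+2 - k)); last first.
  apply: eq_big_nat => k /andP[_ kn].
  by rewrite [(n.+2 - k)%N]subSn ?(ltnW kn)// exprS invfM; ring.
by rewrite [`|s| ^+ n.+1]exprS invfM; lra.
Qed.

Lemma normR_resolvent_halfplane (lambda : R[i]) w : 0 < complex.Re lambda ->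
  normR (resolvent lambda A w) <=
  2 * normR (resolvent ((complex.Im lambda)*i) A w).
Proof.
move=> l0; set s := complex.Im lambda.
(* Outside the range of [lambda - A] the inverse takes its default value 0 and the bound is
   trivial. *)
have [ex|nex] := pselect (exists x, dom A x /\ T lambda x = w); last first.
  rewrite /resolvent {1}/op_inv xgetPN; last by move=> x ?; apply: nex; exists x.
  by rewrite normR0 mulr_ge0 ?normR_ge0.
have [dx Tx] := op_inv_spec (T := T lambda) ex; have [dy Ty] := resolvent_spec s w.
set y := resolvent (s*i) A w in dy Ty *.
rewrite -/(T lambda) -/(resolvent lambda A w) in dx Tx *.
set x := resolvent lambda A w in dx Tx *.
have [dB TB] := linopB (shift_linear lambda linA) dx dy.
have : complex.Re lambda * normR (x - y) <= complex.Re lambda * normR y.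
  apply: le_trans (disA lambda dB) _.
  (* Both [(lambda - A) x] and [(is - A) y] equal [w], and the two shifts differ by [Re lambda];
     dissipativity then gives [|x - y| <= |y|]. *)
  have -> : T lambda (x - y) = (- (complex.Re lambda)%:C) *: y.
    rewrite TB Tx -Ty /T /= opprD addrACA subrr addr0 -scalerBl; congr (_ *: _).
    rewrite /s; case: (lambda) => p q; apply/eqP.
    by rewrite eq_complex /= sub0r subrr oppr0 !eqxx.
  by rewrite normRZ normrN ger0_norm ?ler0c ?(ltW l0).
rewrite ler_pM2l// => h.
have := normR_triangle (x - y) y; rewrite subrK; lra.
Qed.

End ResolventPowers.

(** * From the resolvent bounds to the admissible constant *)

(** With [q = r / s0 >= 1] and [alpha <= n], [q^alpha <= q^n]: beyond [s0] the worst case is [s0]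
    itself. *)
Lemma powR_ratio_le (R : realType) (alpha s0 r : R) (n : nat) :
  0 < s0 -> s0 <= r -> alpha <= n%:R ->
  (1 + r `^ alpha) / r ^+ n <= (1 + s0 `^ alpha) / s0 ^+ n.
Proof.
move=> s00 s0r alpha_n; have r0 : 0 < r by exact: lt_le_trans s0r.
rewrite !mulrDl !mul1r; apply: lerD.
  rewrite lef_pV2 ?posrE ?exprn_gt0//.
  by rewrite lerXn2r ?nnegrE ?(ltW s00) ?(ltW r0).
have q1 : 1 <= r / s0 by rewrite ler_pdivlMr// mul1r.
have rE : r = s0 * (r / s0) by rewrite mulrCA divff ?mulr1// gt_eqF.
rewrite ler_pdivrMr ?exprn_gt0// mulrAC ler_pdivlMr ?exprn_gt0//.
rewrite {1 2}rE powRM ?(ltW s00) ?(le_trans ler01 q1)// exprMn.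
have h : (r / s0) `^ alpha <= (r / s0) ^+ n.
  by rewrite -powR_mulrn ?(le_trans ler01 q1)//; exact: ler_powR.
rewrite (_ : s0 `^ alpha * _ * _ = (s0 `^ alpha * s0 ^+ n) * (r / s0) `^ alpha);
  last by ring.
rewrite (_ : s0 `^ alpha * (_ * _) = (s0 `^ alpha * s0 ^+ n) * (r / s0) ^+ n);
  last by ring.
by rewrite ler_wpM2l// mulr_ge0 ?powR_ge0// exprn_ge0// ltW.
Qed.

Lemma admissible_bound (R : realType) (X : hilbertType R) (A : operator X)
    (beta gamma kappa c : R) : 0 < c ->
  (forall lambda x, 0 < complex.Re lambda -> normR x <= 1 ->
     normR (resolvent lambda A (neg_power (op_opp A) (beta + gamma) x)) <= c) ->
  kappa < 1 / Num.sqrt c -> admissible A beta gamma kappa.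
Proof.
move=> c0 bound; rewrite div1r => kc; rewrite /admissible.
set S := [set _ | _ in _].
have Sc : (ereal_sup S <= (Num.sqrt c)%:E)%E.
  apply: ge_ereal_sup => _ [lambda l0 <-].
  rewrite -powR12_sqrt ?(ltW c0)// -poweR_EFin.
  have hop : (opnorm (resolvent lambda A \o neg_power (op_opp A) (beta + gamma))
     <= c%:E)%E by apply: opnorm_le => x x1; exact: bound.
  apply: gt0_ler_poweR => //.
  - by rewrite in_itv /= opnorm_ge0 leey.
  - by rewrite in_itv /= leey lee_fin ltW.
(* The index [lambda = 1] shows that the family is nonempty, which excludes [-oo]; a zero supremum,
   with inverse [+oo], is treated apart below. *)
have S0 : (0 <= ereal_sup S)%E.
  apply: (@le_trans _ _ (poweR (opnorm (resolvent 1 A \o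
    neg_power (op_opp A) (beta + gamma))) 2^-1)); first exact: poweR_ge0.
  by apply: ereal_sup_ubound; exists 1 => //=; rewrite ltr01.
move: Sc S0; case: (ereal_sup S) => [r| |]//.
rewrite !lee_fin mul1e => rc r0; rewrite inver; case: eqVneq => [_|rn0].
  exact: ltry.
have rp : 0 < r by rewrite lt_def rn0.
rewrite lte_fin; apply: lt_le_trans kc _.
by rewrite lef_pV2 ?posrE ?sqrtr_gt0.
Qed.

(** The exponent [beta + gamma] is a ceiling, so its fractional part is 0 and Balakrishnan's
    integral reduces to the identity. *)
Lemma neg_power_nat (R : realType) (X : hilbertType R) (B : operator X) (n : nat) x :
  neg_power B n%:R x = iter n (op_inv B) x.
Proof. by rewrite /neg_power natrK subrr /frac_neg_power eqxx. Qed.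

Lemma const_MR_gt0 (R : realType) (eta0 delta0 d : R) :
  0 < eta0 -> 0 < delta0 -> 0 <= d -> 0 < const_MR eta0 delta0 d.
Proof.
move=> e0 f0 d0; rewrite /const_MR mulr_gt0// sqrtr_gt0.
rewrite ltr_wpDr ?sqr_ge0//.
apply: ltr_pwDl; first by rewrite mulr_gt0// exprn_gt0.
by rewrite !mulr_ge0// ?exprn_ge0// ltW.
Qed.

Theorem theorem2p3 (R : realType) (X U : hilbertType R) (A0 : operator X)
    (D : {linear U -> X}) (Ds : {linear X -> U})
    (P : R -> R -> {linear X -> X})
    (eta0 delta0 : R) (eta delta : R -> R)
    (hA0 : skew_adjoint A0)
    (hD : continuous D) (hDs : is_adjoint D Ds)
    (hP : forall a b, a < b -> spectral_projection A0 a b (P a b))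
    (heta0 : 0 < eta0) (hdelta0 : 0 < delta0)
    (heta : forall s, 0 < eta s <= eta0)
    (hdelta : forall s, 0 < delta s <= delta0)
    (hobs : forall s x, range (P (s - delta s) (s + delta s)) x ->
       eta s * normR x <= normR (Ds x)) :
  let A := damped A0 D Ds in
  let MR := const_MR eta0 delta0 (fine (opnorm D)) in
  (forall s : R, resolvent_set A (s *i)) /\
  (forall s : R, (opnorm (resolvent (s *i) A) <=
                  (MR / (eta s ^+ 2 * delta s ^+ 2))%:E)%E) /\
  (forall M0 alpha : R, 0 < M0 -> 0 < alpha ->
   (forall s, eta s ^- 2 * delta s ^- 2 <= M0 * (1 + `|s| `^ alpha)) ->
   forall beta gamma : R, 0 <= beta -> 0 <= gamma ->
   beta + gamma = (Num.ceil alpha)%:~R ->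
   forall s0 : R, 0 < s0 ->
   let MC := const_MC MR M0 (fine (opnorm (op_inv A))) alpha
               `|Num.ceil alpha|%N s0 in
   forall kappa : R, 0 < kappa -> kappa < 1 / Num.sqrt (2 * MC) ->
   admissible A beta gamma kappa).
Proof.
move=> A MR.
have MR0 : 0 < MR by apply: const_MR_gt0 => //; exact: opnormD_ge0.
pose M s := MR / (eta s ^+ 2 * delta s ^+ 2).
have M0 s : 0 < M s.
  have [/andP[e0 _] /andP[f0 _]] := (heta s, hdelta s).
  by rewrite divr_gt0// mulr_gt0// exprn_gt0.
have M_ge0 s : 0 <= M s by exact: ltW.
have linA : linear_operator A by exact: damped_linear.
have boundT s x : dom A x ->
    normR x <= M s * normR (op_shift (s*i) (op_opp A) x).
  have [/andP[f0 _]] := hdelta s; apply: (damped_estimate hA0 hD hDs) => //.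
  - by apply: hP; lra.
  - exact: hobs.
have surjT s z : exists x, dom A x /\ op_shift (s*i) (op_opp A) x = z.
  exact: (damped_shift_surjective hA0 hD hDs (M0 s) (boundT s)).
have disA lambda x : dom A x ->
    complex.Re lambda * normR x <= normR (op_shift lambda (op_opp A) x).
  exact: shift_bounded_below.
split=> [s|]; first exact: (resolvent_set_imaginary linA boundT surjT).
split=> [s|N0 alpha N0_gt0 alpha0 growth beta gamma beta0 gamma0 bg s0 s00 MC kappa
  kappa0 kappaMC].
  apply: opnorm_le => x x1; apply: le_trans (normR_resolvent boundT surjT s x) _.
  by rewrite ler_piMr.
set n := `|Num.ceil alpha|%N in MC kappaMC *.
have nE : (Num.ceil alpha)%:~R = n%:R :> R.
  by rewrite /n pmulrn gez0_abs// ltW// ceil_gt0.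
have alpha_n : alpha <= n%:R by rewrite -nE ceil_ge.
set a := fine (opnorm (op_inv A)) in MC kappaMC *.
have a0 : 0 <= a by exact/fine_ge0/opnorm_ge0.
have Mgrowth s : M s <= MR * N0 * (1 + `|s| `^ alpha).
  by rewrite /M invfM -mulrA ler_pM2l.
have MC1 : MR * N0 * a ^+ n * (1 + s0 `^ alpha) <= MC by rewrite le_max lexx.
have MC2 : MR * N0 * (1 + s0 `^ alpha) / s0 ^+ n
     + \sum_(1 <= k < n.+1) a ^+ k / s0 ^+ (n.+1 - k) <= MC.
  by rewrite le_max lexx orbT.
have MC_gt0 : 0 < MC.
  apply: lt_le_trans MC2; apply: ltr_wpDr.
    by apply: sumr_ge0 => k _; rewrite divr_ge0// exprn_ge0// ltW.
  apply: divr_gt0; last exact: exprn_gt0.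
  by apply: mulr_gt0; [exact: mulr_gt0|rewrite ltr_pwDl// powR_ge0].
have axis s x : normR (resolvent (s*i) A (iter n (op_inv (op_opp A)) x)) <=
    MC * normR x.
  (* For [|s| <= s0], bounding the resolvent and the power separately gives the first entry of the
     maximum; beyond [s0] the iterated identity gives the second. *)
  have [ss0|s0s] := leP `|s| s0.
    apply: le_trans (normR_resolvent boundT surjT _ _) _.
    have h := normR_iter_neg_inv linA M_ge0 boundT surjT n x.
    apply: le_trans (ler_wpM2l (M_ge0 s) h) _.
    rewrite mulrA ler_wpM2r ?normR_ge0//; apply: le_trans MC1.
    rewrite [leRHS]mulrAC ler_wpM2r ?exprn_ge0//; apply: le_trans (Mgrowth s) _.
    apply: ler_wpM2l; [by rewrite mulr_ge0 ?ltW|rewrite lerD2l].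
    by apply: ge0_ler_powR; rewrite ?nnegrE ?(ltW alpha0) ?(ltW s00).
  have sn0 : s != 0 by rewrite -normr_gt0 (lt_trans s00).
  apply: le_trans (normR_resolvent_iter linA M_ge0 boundT surjT n x sn0) _.
  rewrite ler_wpM2r ?normR_ge0//; apply: le_trans MC2; apply: lerD.
    apply: (@le_trans _ _ (MR * N0 * ((1 + `|s| `^ alpha) / `|s| ^+ n))).
      by rewrite mulrA ler_wpM2r ?invr_ge0 ?exprn_ge0.
    rewrite -[leRHS]mulrA ler_wpM2l ?mulr_ge0 ?(ltW MR0) ?(ltW N0_gt0)//.
    by rewrite powR_ratio_le// ltW.
  apply: ler_sum => k _; rewrite ler_wpM2l ?exprn_ge0// lef_pV2 ?posrE ?exprn_gt0//.
    by rewrite lerXn2r ?nnegrE ?(ltW s00) ?(ltW s0s).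
  exact: lt_trans s0s.
(* Passing from the axis to the half-plane costs a factor 2, whence [2 * MC] under the root. *)
apply: (admissible_bound _ _ kappaMC); first by rewrite mulr_gt0.
move=> lambda x l0 x1; rewrite bg nE neg_power_nat.
apply: le_trans (normR_resolvent_halfplane linA disA surjT _ l0) _.
rewrite ler_pM2l//; apply: le_trans (axis _ _) _.
by rewrite ler_piMr// ltW.
Qed.
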